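(* Let $\theta$ be a constant with $0<\theta<\pi/2$, and let $$g = \frac{1}{q(x,y)^2}\left(\frac{dx^2}{A(x)}+\frac{dy^2}{B(y)}+A(x)\,ds^2+B(y)\,dt^2+2\sqrt{A(x)B(y)}\,\cos\theta\,ds\,dt\right)$$ be the metric on $U\times T^2$ described in the context. Then $g$ is an Einstein metric if and only if $A$ and $B$ are constants and $q(x,y)=ax+by+c$ for some constants $a$, $b$, and $c$, with $\lambda=-3(a^2A+b^2B)$ in the Einstein metric equation $\mathrm{Ric}(g)=\lambda g$.
   Context: Setting: $U\subset\mathbb{R}^2$ is a nonempty connected open set with coordinates $(x,y)$; $T^2=\mathbb{R}^2/\Gamma$ is a torus ($\Gamma$ a lattice) with periodic coordinates $(s,t)$ (the torus fibers); $q$ is a smooth positive function on $U$; $A=A(x)$ is a smooth positive function of $x$ alone (on the projection of $U$ to the $x$-axis) and $B=B(y)$ is a smooth positive function of $y$ alone (on the projection of $U$ to the $y$-axis). The metric $g$ is a Riemannian metric on the four-manifold $U\times T^2$. It is called non-axisymmetric because $\theta$ is a constant in $(0,\pi/2)$. A metric is Einstein if $\mathrm{Ric}(g)=\lambda g$ for some constant $\lambda\in\mathbb{R}$. *)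

(* Defs.v *)
From HB Require Import structures.
From mathcomp Require Import all_boot all_order all_algebra.
From mathcomp Require Import all_classical all_reals all_analysis.
Set Implicit Arguments.
Unset Strict Implicit.
Unset Printing Implicit Defensive.
Import Order.TTheory GRing.Theory Num.Theory.
Import numFieldNormedType.Exports.
Local Open Scope classical_set_scope.
Local Open Scope ring_scope.

(* C^oo on D: f and all its iterated directional derivatives are Frechet
   differentiable at every point of D. Meaningful when D is open, since
   derivatives at p only see f near p. *)
Definition smooth_on (R : realType) (V : normedModType R)
    (D : set V) (f : V -> R) : Prop :=
  forall (vs : seq V) (p : V), D p ->
    differentiable (foldr (fun v h => 'D_v h) f vs) p.

Section curvature.
Variables (R : realType) (n : nat).
Implicit Types (g : 'rV[R]_n -> 'M[R]_n) (p : 'rV[R]_n).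

Definition partial (i : 'I_n) (f : 'rV[R]_n -> R) : 'rV[R]_n -> R :=
  'D_(delta_mx 0 i) f.

(* christoffel g k i j is the symbol with upper index k, lower indices i, j. *)
Definition christoffel g (k i j : 'I_n) p : R :=
  2^-1 * \sum_(l < n) invmx (g p) k l *
    (partial i (fun z => g z j l) p + partial j (fun z => g z i l) p
     - partial l (fun z => g z i j) p).

(* riemann g l k i j is the d_l-component of R(d_i, d_j) d_k, where
   R(X, Y) = [nabla_X, nabla_Y] - nabla_[X, Y]. *)
Definition riemann g (l k i j : 'I_n) p : R :=
  partial i (christoffel g l j k) p - partial j (christoffel g l i k) p
  + \sum_(m < n) (christoffel g l i m p * christoffel g m j k p
                  - christoffel g l j m p * christoffel g m i k p).

(* Trace convention for which round spheres have positive Ricci curvature. *)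
Definition ricci g p : 'M[R]_n :=
  \matrix_(j, k) \sum_(i < n) riemann g i k i j p.

(* The symmetric product dx_i dx_j, so that dx_i dx_j has off-diagonal
   entries 1/2 when i <> j. *)
Definition dsym (i j : 'I_n) : 'M[R]_n :=
  2^-1 *: (delta_mx i j + delta_mx j i).

End curvature.

Definition lattice (R : realType) (Gamma : set 'rV[R]_2) : Prop :=
  exists2 P : 'M[R]_2, P \in unitmx &
    Gamma = [set z | exists m : 'rV[int]_2, z = map_mx intr m *m P].

Definition kx : 'I_4 := 0.
Definition ky : 'I_4 := 1.
Definition ks : 'I_4 := 2.
Definition kt : 'I_4 := 3.

Section torus_bundle.
Variable R : realType.
Implicit Types (U : set (R * R)) (Gamma : set 'rV[R]_2)
  (g : 'rV[R]_4 -> 'M[R]_4) (p : 'rV[R]_4).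

(* U x R^2, the cover of U x (R^2 / Gamma), in coordinates (x, y, s, t). A
   tensor field on U x (R^2 / Gamma) is represented by its components on this
   cover, which are Gamma-periodic in (s, t). *)
Definition cover U : set 'rV[R]_4 := [set p | U (p 0 kx, p 0 ky)].

Definition translate (gam : 'rV[R]_2) p : 'rV[R]_4 :=
  p + gam 0 0 *: delta_mx 0 ks + gam 0 1 *: delta_mx 0 kt.

Record riemannian_metric U Gamma g : Prop := RiemannianMetric {
  metric_smooth : forall i j, smooth_on (cover U) (fun p => g p i j);
  metric_periodic : forall gam p, Gamma gam -> cover U p ->
    g (translate gam p) = g p;
  metric_sym : forall p, cover U p -> (g p)^T = g p;
  metric_posdef : forall p (v : 'rV[R]_4), cover U p -> v != 0 ->
    0 < (v *m g p *m v^T) 0 0 }.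

Definition einstein_with U Gamma g (lambda : R) : Prop :=
  riemannian_metric U Gamma g /\
  forall p, cover U p -> ricci g p = lambda *: g p.

Definition einstein U Gamma g : Prop :=
  exists lambda : R, einstein_with U Gamma g lambda.

Definition torus_metric (theta : R) (q : R * R -> R) (A B : R -> R) p :
    'M[R]_4 :=
  let x := p 0 kx in let y := p 0 ky in
  (q (x, y) ^+ 2)^-1 *:
    ((A x)^-1 *: dsym R kx kx + (B y)^-1 *: dsym R ky ky
     + A x *: dsym R ks ks + B y *: dsym R kt kt
     + (2 * Num.sqrt (A x * B y) * cos theta) *: dsym R ks kt).

Definition affine_solution U (q : R * R -> R) (A B : R -> R)
    (alpha beta a b c : R) : Prop :=
  [/\ forall x, (fst @` U) x -> A x = alpha,
      forall y, (snd @` U) y -> B y = beta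
    & forall x y, U (x, y) -> q (x, y) = a * x + b * y + c].

End torus_bundle.

(* Main.v *)
Require Import Defs.
From HB Require Import structures.
From mathcomp Require Import all_boot all_order all_algebra.
From mathcomp Require Import all_classical all_reals all_analysis.
From mathcomp Require Import ring lra.
Import Order.TTheory GRing.Theory Num.Theory.
Import numFieldNormedType.Exports.
Local Open Scope classical_set_scope.
Local Open Scope ring_scope.
Set Implicit Arguments.
Unset Strict Implicit.
Unset Printing Implicit Defensive.

(** Write a^2 = A, b^2 = B and c = cos theta, so that the fibre block of the
    metric, up to the factor q^-2, is ((a^2, c a b), (c a b, b^2)).

    The profiles must be constant. The combination
    2 Ric_st / (a b) - c Ric_ss / a^2 - c Ric_tt / b^2 is zero on every multiple
    of the metric. Computed from the Christoffel symbols, it equals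
    c (a^2 (a'/a)^2 + b^2 (b'/b)^2): all terms containing q drop out. Since
    theta < pi/2, c is positive and both squares vanish
    ([fibre_ricci_combination], [einstein_half_dlog0]). The projections of U are
    open and connected, so A and B are constant ([profile_constant]).

    The metric is then K / q^2 with a constant matrix K, and the conformal
    change formula ([ricci_conformally_flat]) gives
    Ric_jk = (3 d_j d_k q - d_k d_j q) / q + S K_jk. As q is independent of s,
    the ss component of the Einstein equation forces S = lambda / q^2; the other
    components make all second derivatives of q vanish ([einstein_hessian0]), and
    q is affine because U is connected ([hessian0_affine]).

    Conversely, for constant A, B and affine q the same formula leaves only
    S = - 3 |dq|^2 / q^2 with |dq|^2 = a^2 A + b^2 B, where a, b are now the
    slopes of q ([ricci_affine]). This is the Einstein equation, and it also
    identifies lambda. It remains to see that the metric is Riemannian: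
    its components are multiples of l^-2 with l affine, hence smooth, and
    sin theta <> 0 makes it positive definite ([riemannian_metric_affine]). *)

(** * Derivatives on open sets of a normed space *)

Section calculus.
Variables (R : realType) (V : normedModType R).
Implicit Types (f g : V -> R) (D : set V) (p v w : V).

Lemma derive_eq_on D f g p v : open D -> {in D, f =1 g} -> D p ->
  'D_v f p = 'D_v g p.
Proof.
move=> oD fg Dp; apply: near_eq_derive.
by near=> z; apply: fg; rewrite inE; near: z; exact: open_nbhs_nbhs.
Unshelve. all: by end_near. Qed.

(** The differential of [f] also expands [g], because the error terms agree
    near the point. *)
Lemma differentiable_eq_on D f g p : open D -> {in D, f =1 g} -> D p ->
  differentiable f p -> differentiable g p.
Proof.
move=> oD fg Dp [[dfc /eqaddoP fo]]; apply/diffP => /=.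
apply: (@getPex _ (fun l : {linear V -> R} => continuous l /\
  forall y, g y = g (lim (nbhs p)) + l (y - lim (nbhs p))
                  +o_(y \near p) (y - lim (nbhs p)))).
exists ('d f p); split=> //.
have : g = cst (g (lim (nbhs p))) + 'd f p \o center (lim (nbhs p))
    +o_p (center (lim (nbhs p))).
  apply/eqaddoP => e e0; near=> z.
  rewrite -[(_ - _) z]/(g z - (g (lim (nbhs p)) + _)).
  rewrite lim_id// -!fg ?inE//; last by near: z; exact: open_nbhs_nbhs.
  by near: z; have := fo e e0; rewrite lim_id.
by rewrite funeqE.
Unshelve. all: by end_near. Qed.

Lemma smooth_on_eq D f g : open D -> {in D, f =1 g} ->
  smooth_on D f -> smooth_on D g.
Proof.
move=> oD fg sf vs p Dp; apply: (differentiable_eq_on oD _ Dp (sf vs p Dp)).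
elim: vs {p Dp} => [|v vs IH] p Dp /=; first exact: fg.
exact: (derive_eq_on v oD IH (set_mem Dp)).
Qed.

(** The rules below restate the sum, product and inverse rules for functions
    given by an abstraction, so that they apply to a formula in the variable by
    higher-order unification. *)
Lemma is_derive_add f g p v df dg : is_derive p v f df -> is_derive p v g dg ->
  is_derive p v (fun z => f z + g z) (df + dg).
Proof. exact: is_deriveD. Qed.

Lemma is_derive_sub f g p v df dg : is_derive p v f df -> is_derive p v g dg ->
  is_derive p v (fun z => f z - g z) (df - dg).
Proof. exact: is_deriveB. Qed.

Lemma is_derive_mul f g p v df dg : is_derive p v f df -> is_derive p v g dg ->
  is_derive p v (fun z => f z * g z) (f p * dg + g p * df).
Proof. exact: is_deriveM. Qed.

Lemma is_derive_exp f n p v df : is_derive p v f df ->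
  is_derive p v (fun z => f z ^+ n) (n%:R * f p ^+ n.-1 * df).
Proof.
move=> h; have := is_deriveX n h.
by rewrite (_ : f ^+ n = fun z => f z ^+ n)//; apply/funext => z; rewrite exprfctE.
Qed.

Lemma differentiable_mul f g p : differentiable f p -> differentiable g p ->
  differentiable (fun z => f z * g z) p.
Proof. exact: differentiableM. Qed.

Lemma differentiable_exp f n p : differentiable f p ->
  differentiable (fun z => f z ^+ n) p.
Proof.
move=> df; have -> : (fun z => f z ^+ n) = f ^+ n.
  by apply/funext => z; rewrite exprfctE.
by case: n => [|n]; [exact: differentiable_cst|exact: differentiableX].
Qed.

Lemma is_derive_inv f p v df : f p != 0 -> is_derive p v f df ->
  is_derive p v (fun z => (f z)^-1) (- (f p) ^- 2 * df).
Proof.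
move=> f0 [fd <-]; apply: DeriveDef; first exact: derivableV.
exact: deriveV.
Qed.

Lemma is_derive_bigsum n (h : 'I_n -> V -> R) p v (dh : 'I_n -> R) :
  (forall i, is_derive p v (h i) (dh i)) ->
  is_derive p v (fun z => \sum_i h i z) (\sum_i dh i).
Proof.
move=> hd; suff -> : (fun z => \sum_i h i z) = \sum_i h i by exact: is_derive_sum.
by apply/funext => z; rewrite fct_sumE.
Qed.

Lemma is_derive_scale f p v (c df : R) : is_derive p v f df ->
  is_derive p v (fun z => c * f z) (c * df).
Proof. exact: is_deriveZ. Qed.

(** On a ball inside [D], restrict [f] to the segment from the centre and
    use the mean value theorem. *)
Lemma differentiable_locally_constant D f : open D ->
    (forall p, D p -> differentiable f p) ->
    (forall p v, D p -> 'D_v f p = 0) ->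
  forall p, D p -> \forall z \near p, f z = f p.
Proof.
move=> oD fd f0 p Dp.
have [e /= e0 eD] : nbhs_ball p D by apply/nbhs_ballP; exact: open_nbhs_nbhs.
apply/nbhs_ballP; exists e => //= z pz.
have sD (t : R) : 0 <= t <= 1 -> D (t *: (z - p) + p).
  move=> /andP[t0 t1]; apply: eD; rewrite -ball_normE /= opprD addrCA subrr addr0.
  rewrite normrN normrZ ger0_norm//; move: pz; rewrite -ball_normE /= distrC => pz.
  by apply: le_lt_trans pz; rewrite ler_piMl.
pose h (t : R) := f (t *: (z - p) + p).
have hd (t : R) : 0 <= t <= 1 -> is_derive t 1 h 0.
  move=> /sD Dt.
  have dl : is_diff t (fun t : R => t *: (z - p) + p) (fun t => t *: (z - p)).
    by apply: is_diff_eq; rewrite addr0.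
  have dh : differentiable h t by apply: differentiable_comp; [exact: ex_diff|exact: fd].
  apply: DeriveDef; first exact: diff_derivable.
  rewrite deriveE// diff_comp//; last exact: fd.
  by rewrite /= diff_val scale1r -deriveE; [exact: f0|exact: fd].
have hc : {within `[0, 1], continuous h}.
  apply: derivable_within_continuous => t; rewrite in_itv => /hd[]//.
have [|t _] := @MVT R h (fun=> 0) 0 1 ltr01 _ hc.
  by move=> t; rewrite in_itv /= => /andP[t0 t1]; apply: hd; rewrite !ltW.
by rewrite /h mul0r scale1r scale0r subrK add0r => /eqP; rewrite subr_eq0 => /eqP.
Qed.

(** The level set of [f p] is open and closed in [D], since [f] is locally
    constant. *)
Lemma derive0_constant_on D f : open D -> connected D ->
    (forall p, D p -> differentiable f p) ->
    (forall p v, D p -> 'D_v f p = 0) ->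
  forall p z, D p -> D z -> f z = f p.
Proof.
move=> oD cD fd f0 p z Dp Dz.
have lc := differentiable_locally_constant oD fd f0.
have E : D `&` [set y | f y = f p] = D.
  apply: cD; first by exists p.
  - exists (D `&` [set y | f y = f p]); last by rewrite setIA setIid.
    rewrite openE => y [Dy fy]; rewrite /interior.
    near=> x; split; near: x; first exact: open_nbhs_nbhs.
    by have := lc _ Dy; apply: filterS => x /= ->.
  - exists (~` (D `&` [set y | f y <> f p])).
      apply: open_closedC; rewrite openE => y [Dy fy]; rewrite /interior.
      near=> x; split; near: x; first exact: open_nbhs_nbhs.
      by have := lc _ Dy; apply: filterS => x /= ->.
    apply/seteqP; split=> y [Dy]; first by move=> fy; split=> // -[].
    by move=> ny; split=> //; apply: contrapT => fy; apply: ny.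
by have : D z by []; rewrite -E => -[].
Unshelve. all: by end_near. Qed.

End calculus.

(** * Pullback by a linear map *)

Section linear_pullback.
Variables (R : realType) (V W : normedModType R) (L : V -> W).
Hypothesis L_linear : linear L.
Implicit Types (f : W -> R) (p v : V).

(** A linear map sends the line through [p] along [v] to the line through
    [L p] along [L v], so the two difference quotients are the same function. *)
Lemma derive_comp_linear f p v : 'D_v (fun z => f (L z)) p = 'D_(L v) f (L p).
Proof.
by rewrite /derive; under eq_fun => h do rewrite /= L_linear.
Qed.

Lemma is_derive_comp_linear f p v : differentiable f (L p) ->
  is_derive p v (fun z => f (L z)) ('D_(L v) f (L p)).
Proof.
move=> f_diff; have fd := @diff_derivable _ _ _ f (L p) (L v) f_diff.
have dE := derive_comp_linear f p v; split; last exact: dE.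
by rewrite /derivable; under eq_fun => h do rewrite /= L_linear.
Qed.

End linear_pullback.

(** * Ricci tensor of a conformally flat metric *)

Lemma sum_delta (R : comPzRingType) n (i : 'I_n) (F : 'I_n -> R) :
  \sum_(m < n) (m == i)%:R * F m = F i.
Proof.
rewrite (bigD1 i)//= eqxx mul1r big1 ?addr0// => m /negPf ->.
by rewrite mul0r.
Qed.

Lemma sum_const_ord (R : pzRingType) n (c : R) : \sum_(i < n) c = n%:R * c.
Proof. by rewrite sumr_const card_ord mulr_natl. Qed.

Section contractions.
Variables (R : comNzRingType) (n : nat) (K : 'M[R]_n) (u w : 'I_n -> R).
Hypotheses (K_sym : forall i j, K i j = K j i)
  (Kw : forall j, \sum_i K i j * w i = u j).
Implicit Types i j k m : 'I_n.

(** For g = K / q^2, with K constant, the Christoffel symbols have this form: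
    [u] is the differential of log q and [w] the K-gradient of log q. *)
Definition conformal_symbol k i j : R :=
  K i j * w k - (k == j)%:R * u i - (k == i)%:R * u j.

Let N := \sum_l u l * w l.

Lemma trace_conformal_symbol m :
  \sum_i conformal_symbol i i m = - n%:R * u m.
Proof.
rewrite /conformal_symbol !sumrB Kw sum_delta subrr sub0r.
under eq_bigr => i _ do rewrite eqxx mul1r.
by rewrite sum_const_ord mulNr.
Qed.

Let contract_lower i j k :
  \sum_m conformal_symbol i j m * conformal_symbol m i k =
    u j * u k - K j k * (u i * w i) - u k * (K i j * w i)
    + u j * ((i == k)%:R * u i)
    - N * ((i == j)%:R * K i k) + 2 * u k * ((i == j)%:R * u i).
Proof.
(* The nine products, each sorted into a factor free of m and a contraction
   over m. *)
rewrite (eq_bigr (fun m => (K i k * w i) * (K m j * w m)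
    - (w i * u i) * ((m == k)%:R * K m j) - (w i * u k) * ((m == i)%:R * K m j)
    - (u j * K i k) * ((m == i)%:R * w m)
    + (u j * u i) * ((m == i)%:R * (m == k)%:R)
    + (u j * u k) * ((m == i)%:R * (m == i)%:R)
    - ((i == j)%:R * K i k) * (u m * w m)
    + ((i == j)%:R * u i) * ((m == k)%:R * u m)
    + ((i == j)%:R * u k) * ((m == i)%:R * u m))); last first.
  by move=> m _; rewrite /conformal_symbol (eq_sym i m) (K_sym j m); ring.
rewrite !(sumrB, big_split) /= -!mulr_sumr !sum_delta Kw eqxx -/N (K_sym k j).
rewrite [true%:R]mulr1n.
by ring.
Qed.

(** The part of the Ricci tensor that is quadratic in the Christoffel
    symbols. The contraction of the first product uses only the trace; in the
    second one each of the nine terms contains a Kronecker delta, or pairs K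
    with [w], and collapses. *)
Lemma quadratic_conformal_symbol j k :
  \sum_i \sum_m (conformal_symbol i i m * conformal_symbol m j k -
                 conformal_symbol i j m * conformal_symbol m i k) =
  (n%:R - 2) * (u j * u k - K j k * N).
Proof.
transitivity (\sum_i \sum_m conformal_symbol i i m * conformal_symbol m j k
            - \sum_i \sum_m conformal_symbol i j m * conformal_symbol m i k).
  by rewrite -sumrB; apply: eq_bigr => i _; rewrite sumrB.
have -> : \sum_i \sum_m conformal_symbol i i m * conformal_symbol m j k =
    n%:R * (2 * u j * u k - K j k * N).
  rewrite exchange_big /=.
  under eq_bigr => m _ do rewrite -mulr_suml trace_conformal_symbol.
  rewrite (eq_bigr (fun m => n%:R * (u j * ((m == k)%:R * u m)
     + u k * ((m == j)%:R * u m) - K j k * (u m * w m)))); last first.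
    by move=> m _; rewrite /conformal_symbol; ring.
  rewrite -mulr_sumr sumrB big_split /= -!mulr_sumr !sum_delta -/N.
  by ring.
under eq_bigr => i _ do rewrite contract_lower.
rewrite !(sumrB, big_split) /= -!mulr_sumr !sum_delta Kw -/N.
by rewrite sum_const_ord; ring.
Qed.

(** The part of the Ricci tensor that is linear in the first derivatives of
    the Christoffel symbols: [H] stands for the second derivatives of log q,
    [T] for the summands of its K-Laplacian, [Y] for a row of [H] with the index
    raised. *)
Lemma divergence_conformal_symbol (H : 'I_n -> 'I_n -> R) (T Y : 'I_n -> R) j k :
    \sum_i K i k * Y i = H j k ->
  \sum_i (K j k * T i - (i == k)%:R * H i j - (i == j)%:R * H i k
         - (K i k * Y i - (i == k)%:R * H j i - (i == i)%:R * H j k)) =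
  (n%:R - 1) * H j k - H k j + K j k * \sum_i T i.
Proof.
move=> KY; rewrite !sumrB -mulr_sumr KY (sum_delta k (H^~ j)).
rewrite (sum_delta j (H^~ k)) (sum_delta k (H j)).
under [X in _ - (_ - X)]eq_bigr => i _ do rewrite eqxx mul1r.
by rewrite sum_const_ord; ring.
Qed.

End contractions.

Section conformally_flat.
Variables (R : realType) (n : nat) (D : set 'rV[R]_n) (q : 'rV[R]_n -> R)
  (K : 'M[R]_n) (g : 'rV[R]_n -> 'M[R]_n).
Hypotheses (D_open : open D) (q_neq0 : forall p, D p -> q p != 0)
  (q_diff : forall p, D p -> differentiable q p)
  (dq_diff : forall p i, D p -> differentiable (partial i q) p)
  (K_unit : K \in unitmx) (K_sym : K^T = K)
  (gE : forall p, D p -> g p = (q p ^+ 2)^-1 *: K).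
Implicit Types (p : 'rV[R]_n) (i j k l m : 'I_n).

Let K' := invmx K.

Let dlog i p := partial i q p / q p.

Let grad k p := \sum_l K' k l * dlog l p.

Let Gam k i j p := conformal_symbol K (dlog^~ p) (grad^~ p) k i j.

Let hess m i p := partial m (partial i q) p / q p - dlog m p * dlog i p.

Let K_symE i j : K i j = K j i.
Proof. by rewrite -[in LHS]K_sym mxE. Qed.

Let sum_invK k j : \sum_l K' k l * K j l = (k == j)%:R.
Proof.
have := mulVmx K_unit => /matrixP/(_ k j); rewrite !mxE => <-.
by apply: eq_bigr => l _; rewrite K_symE.
Qed.

Let christoffel_conformally_flat k i j p : D p ->
  christoffel g k i j p = Gam k i j p.
Proof.
move=> Dp; have q0 := q_neq0 Dp.
have dg a b c : partial a (fun z => g z b c) p =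
    - 2 * (q p ^+ 2)^-1 * (K b c * dlog a p).
  rewrite /partial (derive_eq_on (g := fun z => K b c * (q z ^+ 2)^-1) _ D_open _ Dp).
    have -> : - 2 * (q p ^+ 2)^-1 * (K b c * dlog a p) =
        K b c * (- (q p ^+ 2) ^- 2 * (2%:R * q p ^+ 2.-1 * partial a q p)) +
        (q p ^+ 2)^-1 * 0.
      by rewrite /dlog /=; field.
    apply: derive_val; apply: is_derive_mul; apply: is_derive_inv.
      by rewrite expf_neq0.
    by apply: is_derive_exp; apply/derivableP/diff_derivable/q_diff.
  by move=> z; rewrite inE => Dz; rewrite gE// mxE mulrC.
rewrite /christoffel gE// invmxZ//; last first.
  by rewrite unitmxZ// unitfE invr_eq0 expf_neq0.
under eq_bigr => l _ do rewrite !dg mxE -/K'.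
rewrite (eq_bigr (fun l => - 2 * (dlog i p * (K' k l * K j l) +
   dlog j p * (K' k l * K i l) - K i j * (K' k l * dlog l p)))); last first.
  move=> l _; move: (dlog i p) (dlog j p) (dlog l p) (K' k l) (K j l) (K i l).
  by move: (K i j) (q p) q0 => x1 r r0 x2 x3 x4 x5 x6 x7; field.
rewrite -mulr_sumr sumrB big_split /= -!mulr_sumr !sum_invK// /Gam /conformal_symbol /grad.
move: (\sum_(l < n) _) (K i j) (dlog i p) (dlog j p) => S Kij ui uj.
by field.
Qed.

Let dlog_derive m i p : D p -> is_derive p (delta_mx 0 m) (dlog i) (hess m i p).
Proof.
move=> Dp; have q0 := q_neq0 Dp; rewrite /dlog.
have -> : hess m i p = partial i q p * (- (q p) ^- 2 * partial m q p) +
    (q p)^-1 * partial m (partial i q) p.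
  by rewrite /hess /dlog; field.
apply: is_derive_mul; first exact/derivableP/diff_derivable/dq_diff.
by apply: is_derive_inv => //; exact/derivableP/diff_derivable/q_diff.
Qed.

Let Gam_derive m k i j p : D p -> is_derive p (delta_mx 0 m) (Gam k i j)
  (K i j * (\sum_l K' k l * hess m l p) - (k == j)%:R * hess m i p
   - (k == i)%:R * hess m j p).
Proof.
move=> Dp; rewrite /Gam /conformal_symbol /grad.
apply: is_derive_sub; last by apply/is_derive_scale/dlog_derive.
apply: is_derive_sub; last by apply/is_derive_scale/dlog_derive.
apply/is_derive_scale/is_derive_bigsum => l.
by apply/is_derive_scale/dlog_derive.
Qed.

Let sum_K_invK k (F : 'I_n -> R) :
  \sum_i K i k * (\sum_l K' i l * F l) = F k.
Proof.
under eq_bigr => i _ do rewrite mulr_sumr.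
rewrite exchange_big /= -[RHS](sum_delta k F).
apply: eq_bigr => l _; under eq_bigr => i _ do rewrite mulrA.
rewrite -mulr_suml; congr (_ * _).
have := mulmxV K_unit => /matrixP/(_ k l); rewrite !mxE eq_sym => <-.
by apply: eq_bigr => i _; rewrite K_symE.
Qed.

Let norm2 p := \sum_l dlog l p * grad l p.

(** The classical conformal change formula, applied to a flat metric. The
    two orders of differentiation of [q] are kept apart: the usual term
    (n - 2) d_j d_k q appears as (n - 1) d_j d_k q - d_k d_j q. *)
Lemma ricci_conformally_flat p : D p -> ricci g p = \matrix_(j, k)
  (((n%:R - 1) * partial j (partial k q) p - partial k (partial j q) p) / q p
  + K j k * \sum_i \sum_l invmx K i l *
      (partial i (partial l q) p / q p
       - (n%:R - 1) * partial i q p * partial l q p / q p ^+ 2)).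
Proof.
move=> Dp; have q0 := q_neq0 Dp; apply/matrixP => j k; rewrite !mxE.
have dGam m a b c : partial m (christoffel g a b c) p =
    K b c * (\sum_l K' a l * hess m l p) - (a == c)%:R * hess m b p
    - (a == b)%:R * hess m c p.
  rewrite /partial (derive_eq_on (g := Gam a b c) _ D_open _ Dp).
    exact/derive_val/Gam_derive.
  by move=> z; rewrite inE; exact: christoffel_conformally_flat.
rewrite /riemann.
under eq_bigr => i _ do under eq_bigr => m _ do
  rewrite !christoffel_conformally_flat//.
rewrite big_split /= quadratic_conformal_symbol//; last by move=> m; exact: sum_K_invK.
under eq_bigr => i _ do rewrite !dGam.
rewrite (@divergence_conformal_symbol _ _ K (fun a b => hess a b p)
  (fun i => \sum_l K' i l * hess i l p) (fun i => \sum_l K' i l * hess j l p) j k);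
  last exact: (sum_K_invK k (fun l => hess j l p)).
have -> : \sum_i \sum_l K' i l * (partial i (partial l q) p / q p -
       (n%:R - 1) * partial i q p * partial l q p / q p ^+ 2) =
    \sum_i \sum_l K' i l * hess i l p - (n%:R - 2) * norm2 p.
  rewrite /norm2 /grad mulr_sumr -sumrB; apply: eq_bigr => i _.
  rewrite mulr_sumr mulr_sumr -sumrB; apply: eq_bigr => l _; rewrite /hess /dlog.
  move: (K' i l) (partial i (partial l q) p) (partial i q p) (partial l q p).
  by move: (q p) q0 => r r0 x y z t; field.
rewrite -/(norm2 p) /hess /dlog; move: (norm2 p) (\sum_i _) (K j k) => N S Kjk.
move: (partial j q p) (partial k q p) (partial j (partial k q) p).
move: (partial k (partial j q) p) (q p) q0 => x r r0 y z t.
by field.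
Qed.

End conformally_flat.

(** * Metrics that are block diagonal in the four coordinates *)

Section torus_form.
Variable R : realType.

(** The coordinates come in the order x, y, s, t; the only off-diagonal
    coefficient pairs s with t. *)
Definition torus_form (gxx gyy gss gtt gst : R) : 'M[R]_4 :=
  \matrix_(i, j) match val i, val j with
  | 0, 0 => gxx | 1, 1 => gyy | 2, 2 => gss | 3, 3 => gtt
  | 2, 3 | 3, 2 => gst | _, _ => 0
  end.

Lemma ord4_ind (P : 'I_4 -> Prop) :
  P kx -> P ky -> P ks -> P kt -> forall i, P i.
Proof.
move=> Px Py Ps Pt [[|[|[|[|//]]]] i4].
- by rewrite (_ : Ordinal _ = kx)//; exact: val_inj.
- by rewrite (_ : Ordinal _ = ky)//; exact: val_inj.
- by rewrite (_ : Ordinal _ = ks)//; exact: val_inj.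
- by rewrite (_ : Ordinal _ = kt)//; exact: val_inj.
Qed.

Lemma sum_ord4 (F : 'I_4 -> R) : \sum_i F i = F kx + F ky + F ks + F kt.
Proof.
rewrite !big_ord_recr big_ord0 /= add0r.
by congr (F _ + F _ + F _ + F _); apply: val_inj.
Qed.

Lemma val_kx : val kx = 0%N. Proof. by []. Qed.
Lemma val_ky : val ky = 1%N. Proof. by []. Qed.
Lemma val_ks : val ks = 2%N. Proof. by []. Qed.
Lemma val_kt : val kt = 3%N. Proof. by []. Qed.
(** Rewriting with these equations lets the matches on indices reduce. *)
Definition val_index := (val_kx, val_ky, val_ks, val_kt).

Lemma torus_form_sym gxx gyy gss gtt gst :
  (torus_form gxx gyy gss gtt gst)^T = torus_form gxx gyy gss gtt gst.
Proof.
by apply/matrixP; apply: ord4_ind; apply: ord4_ind; rewrite !mxE !val_index.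
Qed.

Lemma torus_formZ r gxx gyy gss gtt gst :
  r *: torus_form gxx gyy gss gtt gst =
  torus_form (r * gxx) (r * gyy) (r * gss) (r * gtt) (r * gst).
Proof.
by apply/matrixP; apply: ord4_ind; apply: ord4_ind;
  rewrite !mxE !val_index ?mulr0.
Qed.

Lemma torus_form_inverse gxx gyy gss gtt gst (d := gss * gtt - gst ^+ 2) :
    gxx != 0 -> gyy != 0 -> d != 0 ->
  torus_form gxx gyy gss gtt gst *m
    torus_form gxx^-1 gyy^-1 (gtt / d) (gss / d) (- gst / d) = 1%:M.
Proof.
move=> x0 y0 d0; apply/matrixP.
apply: ord4_ind; apply: ord4_ind; rewrite mxE sum_ord4 !mxE !val_index /=;
  rewrite ?(mul0r, mulr0, add0r, addr0) ?mulfV//.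
all: by rewrite /d in d0 *; field.
Qed.

Lemma torus_form_unit gxx gyy gss gtt gst :
  gxx != 0 -> gyy != 0 -> gss * gtt - gst ^+ 2 != 0 ->
  torus_form gxx gyy gss gtt gst \in unitmx.
Proof. by move=> x0 y0 d0; have /mulmx1_unit[] := torus_form_inverse x0 y0 d0. Qed.

Lemma invmx_torus_form gxx gyy gss gtt gst (d := gss * gtt - gst ^+ 2) :
    gxx != 0 -> gyy != 0 -> d != 0 ->
  invmx (torus_form gxx gyy gss gtt gst) =
    torus_form gxx^-1 gyy^-1 (gtt / d) (gss / d) (- gst / d).
Proof.
move=> x0 y0 d0; have gU := torus_form_unit x0 y0 d0.
by rewrite -[RHS](mulKmx gU) torus_form_inverse// mulmx1.
Qed.

Lemma dsym_torus_form gxx gyy gss gtt gst :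
  gxx *: dsym R kx kx + gyy *: dsym R ky ky + gss *: dsym R ks ks
  + gtt *: dsym R kt kt + (2 * gst) *: dsym R ks kt =
  torus_form gxx gyy gss gtt gst.
Proof.
apply/matrixP; apply: ord4_ind; apply: ord4_ind;
  by rewrite !mxE -!val_eqE !val_index /=; field.
Qed.

Lemma torus_metricE theta (q : R * R -> R) (A B : R -> R)
    (p : 'rV[R]_4) (x := p 0 kx) (y := p 0 ky) :
  torus_metric theta q A B p = (q (x, y) ^+ 2)^-1 *:
    torus_form (A x)^-1 (B y)^-1 (A x) (B y) (Num.sqrt (A x * B y) * cos theta).
Proof.
by rewrite /torus_metric /= -/x -/y -mulrA dsym_torus_form.
Qed.

End torus_form.

(* Comparing two coordinate indices by unfolding would compute in Z/4; [val_index]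
   replaces that computation from here on. *)
Local Opaque kx ky ks kt.

(** * Fibre components of the Ricci tensor *)

Section weighted.
Variables (R : realType) (V : normedModType R).
Implicit Types (f h w r : V -> R) (p v : V).

(** The shape of every Christoffel symbol with a base index up and two fibre
    indices down: up to the factor c, a monomial in the profiles [f], [h]
    times a combination of the logarithmic derivatives [w] of q and [r] of [f]. *)
Definition weighted f h (m n : nat) (t : R) w r (p : V) : R :=
  f p ^+ m * h p ^+ n * (w p - t * r p).

Lemma is_derive_weighted f h m n t w r p v :
  is_derive p v f (r p * f p) -> is_derive p v h 0 ->
  derivable w p v -> derivable r p v ->
  is_derive p v (weighted f h m n t w r)
    (f p ^+ m * h p ^+ n *
     (m%:R * r p * (w p - t * r p) + ('D_v w p - t * 'D_v r p))).
Proof.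
move=> df dh dw dr.
have := is_derive_mul (is_derive_mul (is_derive_exp m df) (is_derive_exp n dh))
  (is_derive_sub (derivableP dw) (is_derive_scale t (derivableP dr))).
congr is_derive; rewrite !mulr0; case: m => [|m]; last by rewrite exprS /=; ring.
by rewrite expr0; ring.
Qed.

End weighted.

(** The metric considered here is
    q^-2 (dx^2 / a^2 + dy^2 / b^2 + a^2 ds^2 + b^2 dt^2 + 2 c a b ds dt), where
    [u], [v] are the logarithmic derivatives of [q] along x and y, and [al], [be]
    those of [a] along x and of [b] along y. *)
Section fibre_ricci.
Variables (R : realType) (D : set 'rV[R]_4) (g : 'rV[R]_4 -> 'M[R]_4) (c : R)
  (q a b u v al be : 'rV[R]_4 -> R).

Let base_covector (x y : R) (i : 'I_4) : R :=
  match val i with 0 => x | 1 => y | _ => 0 end.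

Local Notation e i := (delta_mx 0 i : 'rV[R]_4).

Hypotheses (D_open : open D) (c2_neq1 : 1 - c ^+ 2 != 0)
  (q_neq0 : forall p, D p -> q p != 0) (a_neq0 : forall p, D p -> a p != 0)
  (b_neq0 : forall p, D p -> b p != 0)
  (gE : forall p, D p -> g p = (q p ^+ 2)^-1 *:
     torus_form (a p ^+ 2)^-1 (b p ^+ 2)^-1 (a p ^+ 2) (b p ^+ 2) (a p * b p * c))
  (dq : forall p i, D p -> is_derive p (e i) q (base_covector (u p) (v p) i * q p))
  (da : forall p i, D p -> is_derive p (e i) a (base_covector (al p) 0 i * a p))
  (db : forall p i, D p -> is_derive p (e i) b (base_covector 0 (be p) i * b p))
  (du : forall p, D p -> derivable u p (e kx))
  (dv : forall p, D p -> derivable v p (e ky))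
  (dal : forall p, D p -> derivable al p (e kx))
  (dbe : forall p, D p -> derivable be p (e ky)).
Implicit Types (p : 'rV[R]_4) (i j k l m : 'I_4).

Let partial_metric i j l p : D p -> partial i (fun z => g z j l) p =
  (- 2 / q p ^+ 2) * torus_form
    ((base_covector (u p) (v p) i + base_covector (al p) 0 i) / a p ^+ 2)
    ((base_covector (u p) (v p) i + base_covector 0 (be p) i) / b p ^+ 2)
    ((base_covector (u p) (v p) i - base_covector (al p) 0 i) * a p ^+ 2)
    ((base_covector (u p) (v p) i - base_covector 0 (be p) i) * b p ^+ 2)
    ((base_covector (u p) (v p) i - base_covector (al p) (be p) i / 2) * (a p * b p * c)) j l.
Proof.
move=> Dp; have [[q0 a0] b0] := (q_neq0 Dp, a_neq0 Dp, b_neq0 Dp).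
have [[dqp dap] dbp] := (dq i Dp, da i Dp, db i Dp).
have ab : base_covector (al p) (be p) i = base_covector (al p) 0 i + base_covector 0 (be p) i.
  by rewrite /base_covector; case: (val i) => [|[|_]]; rewrite ?addr0 ?add0r.
(* The logarithmic derivative of q^-2 is -2 (u dx + v dy); factoring out
   -2 / q^2 leaves half of the derivative of f, with the opposite sign. *)
have dE (f : 'rV[R]_4 -> R) j1 l1 d d' :
    (forall z, D z -> g z j1 l1 = (q z ^+ 2)^-1 * f z) ->
    is_derive p (e i) f d ->
    d' = - 2 / q p ^+ 2 * (base_covector (u p) (v p) i * f p - d / 2) ->
    partial i (fun z => g z j1 l1) p = d'.
  move=> gf fd ->.
  rewrite /partial (derive_eq_on (g := fun z => (q z ^+ 2)^-1 * f z) _ D_open _ Dp).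
    rewrite (_ : _ * _ = (q p ^+ 2)^-1 * d + f p *
      (- (q p ^+ 2) ^- 2 * (2%:R * q p ^+ 2.-1 * (base_covector (u p) (v p) i * q p)))).
      apply: derive_val; apply: is_derive_mul; apply: is_derive_inv.
        by rewrite expf_neq0.
      exact: is_derive_exp.
    by rewrite /=; field.
  by move=> z; rewrite inE => /gf.
have d0 : is_derive p (e i) (fun=> 0 : R) 0 by exact: is_derive_cst.
have da2 := is_derive_exp 2 dap; have db2 := is_derive_exp 2 dbp.
have da2V := is_derive_inv (f := fun z => a z ^+ 2) (expf_neq0 2 a0) da2.
have db2V := is_derive_inv (f := fun z => b z ^+ 2) (expf_neq0 2 b0) db2.
have dab := is_derive_mul (is_derive_mul dap dbp) (is_derive_cst c p (e i)).
move: j l; apply: ord4_ind; apply: ord4_ind.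
all: first [apply: (dE _ _ _ _ _ _ d0); [|by rewrite mxE !val_index /=; field]
  |apply: (dE _ _ _ _ _ _ da2V); [|by rewrite mxE !val_index /=; field; rewrite a0 q0]
  |apply: (dE _ _ _ _ _ _ db2V); [|by rewrite mxE !val_index /=; field; rewrite b0 q0]
  |apply: (dE _ _ _ _ _ _ da2); [|by rewrite mxE !val_index /=; field]
  |apply: (dE _ _ _ _ _ _ db2); [|by rewrite mxE !val_index /=; field]
  |apply: (dE _ _ _ _ _ _ dab); [|by rewrite mxE !val_index /= ab; field]].
all: by move=> z Dz; rewrite gE// !mxE !val_index.
Qed.

Let inverse_metric p : D p -> invmx (g p) = q p ^+ 2 *:
  torus_form (a p ^+ 2) (b p ^+ 2) (a p ^+ 2 * (1 - c ^+ 2))^-1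
    (b p ^+ 2 * (1 - c ^+ 2))^-1 (- c / (a p * b p * (1 - c ^+ 2))).
Proof.
move=> Dp; have [[q0 a0] b0] := (q_neq0 Dp, a_neq0 Dp, b_neq0 Dp).
have det : a p ^+ 2 * b p ^+ 2 - (a p * b p * c) ^+ 2 =
  a p ^+ 2 * b p ^+ 2 * (1 - c ^+ 2) by ring.
have det0 : a p ^+ 2 * b p ^+ 2 - (a p * b p * c) ^+ 2 != 0.
  by rewrite det !mulf_neq0 ?expf_neq0.
have [a20 b20] : (a p ^+ 2)^-1 != 0 /\ (b p ^+ 2)^-1 != 0.
  by rewrite !invr_eq0 !expf_neq0.
rewrite gE// invmxZ; last first.
  by rewrite unitmxZ ?torus_form_unit// unitfE invr_eq0 expf_neq0.
rewrite invrK invmx_torus_form// !invrK det; congr (_ *: torus_form _ _ _ _ _).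
all: by field; rewrite ?a0 ?b0 ?c2_neq1.
Qed.

(** The Christoffel symbols, with [k] the upper index; [s] = 1 / sin^2 theta
    comes from inverting the fibre block. *)
Let Gam k i j p : R :=
  let s := (1 - c ^+ 2)^-1 in
  match val k, val i, val j with
  | 0, 0, 0 => - (u p + al p)
  | 0, 0, 1 | 0, 1, 0 => - v p
  | 0, 1, 1 => a p ^+ 2 / b p ^+ 2 * u p
  | 0, 2, 2 => a p ^+ 4 * (u p - al p)
  | 0, 2, 3 | 0, 3, 2 => c * (a p ^+ 3 * b p * (u p - al p / 2))
  | 0, 3, 3 => a p ^+ 2 * b p ^+ 2 * u p
  | 1, 1, 1 => - (v p + be p)
  | 1, 0, 1 | 1, 1, 0 => - u p
  | 1, 0, 0 => b p ^+ 2 / a p ^+ 2 * v p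
  | 1, 3, 3 => b p ^+ 4 * (v p - be p)
  | 1, 2, 3 | 1, 3, 2 => c * (b p ^+ 3 * a p * (v p - be p / 2))
  | 1, 2, 2 => b p ^+ 2 * a p ^+ 2 * v p
  | 2, 0, 2 | 2, 2, 0 => al p * (1 + s) / 2 - u p
  | 2, 0, 3 | 2, 3, 0 => al p * s * c * b p / (2 * a p)
  | 2, 1, 2 | 2, 2, 1 => be p * (1 - s) / 2 - v p
  | 2, 1, 3 | 2, 3, 1 => - (be p * s * c * b p / (2 * a p))
  | 3, 1, 3 | 3, 3, 1 => be p * (1 + s) / 2 - v p
  | 3, 1, 2 | 3, 2, 1 => be p * s * c * a p / (2 * b p)
  | 3, 0, 3 | 3, 3, 0 => al p * (1 - s) / 2 - u p
  | 3, 0, 2 | 3, 2, 0 => - (al p * s * c * a p / (2 * b p))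
  | _, _, _ => 0
  end.

Let christoffelE k i j p : D p -> christoffel g k i j p = Gam k i j p.
Proof.
move=> Dp; have [[q0 a0] b0] := (q_neq0 Dp, a_neq0 Dp, b_neq0 Dp).
rewrite /christoffel inverse_metric// sum_ord4 !partial_metric// !mxE.
move: k i j; apply: ord4_ind; apply: ord4_ind; apply: ord4_ind;
  rewrite /Gam /base_covector !val_index /=.
all: by field; rewrite ?q0 ?a0 ?b0 ?c2_neq1.
Qed.

Let partial_christoffel m k i j f d p : D p -> Gam k i j =1 f ->
  is_derive p (e m) f d -> partial m (christoffel g k i j) p = d.
Proof.
move=> Dp Gf dd; rewrite /partial (derive_eq_on (g := f) _ D_open _ Dp).
  exact: derive_val.
by move=> z; rewrite inE => Dz; rewrite christoffelE.
Qed.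

(** For fibre indices [j], [k] the symbols Gamma^i_ik and those with a fibre
    index up vanish, so the only derivatives left are those of Gamma^x_jk along x
    and of Gamma^y_jk along y. *)
Let fibre_ricciE j k X Y p : D p -> (forall i, Gam i i k =1 (fun=> 0)) ->
    Gam ks j k =1 (fun=> 0) -> Gam kt j k =1 (fun=> 0) ->
    partial kx (christoffel g kx j k) p = X ->
    partial ky (christoffel g ky j k) p = Y ->
  ricci g p j k = X + Y + \sum_i \sum_m
    (Gam i i m p * Gam m j k p - Gam i j m p * Gam m i k p).
Proof.
move=> Dp G0 Gs Gt pX pY.
have d0 m i' j' k' : Gam i' j' k' =1 (fun=> 0) ->
    partial m (christoffel g i' j' k') p = 0.
  by move=> Gz; apply: (partial_christoffel Dp Gz); exact: is_derive_cst.
rewrite mxE /riemann big_split /=; congr (_ + _); last first.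
  by apply: eq_bigr => i _; apply: eq_bigr => m _; rewrite !christoffelE.
rewrite sumrB [X in _ - X]big1 ?subr0; last by move=> i _; exact: d0 (G0 i).
by rewrite sum_ord4 pX pY (d0 ks _ _ _ Gs) (d0 kt _ _ _ Gt) !addr0.
Qed.

(** The functional S -> 2 S_st / (a b) - c S_ss / a^2 - c S_tt / b^2 vanishes
    on the fibre block of the metric, on its x- and y-derivatives, and therefore
    on every term of the Ricci tensor that involves q. What remains is a sum of
    squares. *)
Lemma fibre_ricci_combination p : D p ->
  2 * ricci g p ks kt / (a p * b p) - c * ricci g p ks ks / a p ^+ 2
    - c * ricci g p kt kt / b p ^+ 2 =
  c * (a p ^+ 2 * al p ^+ 2 + b p ^+ 2 * be p ^+ 2).
Proof.
move=> Dp; have [[q0 a0] b0] := (q_neq0 Dp, a_neq0 Dp, b_neq0 Dp).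
have [dax dbx] : is_derive p (e kx) a (al p * a p) /\ is_derive p (e kx) b 0.
  by split; [exact: da|have := db kx Dp; rewrite mul0r].
have [dby day] : is_derive p (e ky) b (be p * b p) /\ is_derive p (e ky) a 0.
  by split; [exact: db|have := da ky Dp; rewrite mul0r].
have dx (m n : nat) (t : R) := is_derive_weighted m n t dax dbx (du Dp) (dal Dp).
have dy (m n : nat) (t : R) := is_derive_weighted m n t dby day (dv Dp) (dbe Dp).
have dcx (t : R) := is_derive_scale c (dx 3%N 1%N t).
have dcy (t : R) := is_derive_scale c (dy 3%N 1%N t).
have Gxss : Gam kx ks ks =1 weighted a b 4 0 1 u al.
  by move=> z; rewrite /Gam /weighted !val_index; ring.
have xss := partial_christoffel Dp Gxss (dx 4%N 0%N 1).
have Gxtt : Gam kx kt kt =1 weighted a b 2 2 0 u al.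
  by move=> z; rewrite /Gam /weighted !val_index; ring.
have xtt := partial_christoffel Dp Gxtt (dx 2%N 2%N 0).
have Gyss : Gam ky ks ks =1 weighted b a 2 2 0 v be.
  by move=> z; rewrite /Gam /weighted !val_index; ring.
have yss := partial_christoffel Dp Gyss (dy 2%N 2%N 0).
have Gytt : Gam ky kt kt =1 weighted b a 4 0 1 v be.
  by move=> z; rewrite /Gam /weighted !val_index; ring.
have ytt := partial_christoffel Dp Gytt (dy 4%N 0%N 1).
have Gxst : Gam kx ks kt =1 (fun z => c * weighted a b 3 1 2^-1 u al z).
  by move=> z; rewrite /Gam /weighted !val_index; ring.
have xst := partial_christoffel Dp Gxst (dcx 2^-1).
have Gyst : Gam ky ks kt =1 (fun z => c * weighted b a 3 1 2^-1 v be z).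
  by move=> z; rewrite /Gam /weighted !val_index; ring.
have yst := partial_christoffel Dp Gyst (dcy 2^-1).
have trace0 k : (k = ks) \/ (k = kt) -> forall i, Gam i i k =1 (fun=> 0).
  by case=> ->; apply: ord4_ind => z; rewrite /Gam !val_index.
have fibre0 i j k : (i = ks) \/ (i = kt) -> (j = ks) \/ (j = kt) ->
    (k = ks) \/ (k = kt) -> Gam i j k =1 (fun=> 0).
  by case=> ->; case=> ->; case=> -> z; rewrite /Gam !val_index.
rewrite (fibre_ricciE Dp _ _ _ xss yss); try by auto.
rewrite (fibre_ricciE Dp _ _ _ xst yst); try by auto.
rewrite (fibre_ricciE Dp _ _ _ xtt ytt); try by auto.
rewrite !sum_ord4 /Gam !val_index.
by field; rewrite c2_neq1 a0 b0.
Qed.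

End fibre_ricci.

(** * Smoothness, positivity and the base projection *)

Section affine_powers.
Variables (R : realType) (V : normedModType R) (D : set V) (l : V -> R)
  (dl : V -> R).
Hypotheses (D_open : open D) (l_neq0 : forall p, D p -> l p != 0)
  (l_diff : forall p, differentiable l p) (l_der : forall p v, 'D_v l p = dl v).

(** The functions k / l^m with [l] affine are closed under directional
    derivatives. *)
Lemma smooth_affine_inv_power (k : R) (m : nat) :
  smooth_on D (fun p => k * (l p ^+ m)^-1).
Proof.
move=> vs p Dp.
have [k' [m' fE]] : exists k' m', {in D, (fun p => k' * (l p ^+ m')^-1) =1
    foldr (fun v h => 'D_v h) (fun p => k * (l p ^+ m)^-1) vs}.
  elim: vs => [|v vs [k' [m' IH]]]; first by exists k, m.
  exists (- (m'%:R * k' * dl v)), m'.+1 => z; rewrite inE => Dz.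
  have lz := l_neq0 Dz.
  rewrite /= -(derive_eq_on v D_open IH Dz).
  have hl : is_derive z v l (dl v).
    by rewrite -(l_der z v); exact/derivableP/diff_derivable/l_diff.
  have := is_derive_scale k' (is_derive_inv (f := fun z => l z ^+ m')
    (expf_neq0 m' lz) (is_derive_exp m' hl)).
  move/(@derive_val _ _ _ _ _ _ _) => ->; case: m' {IH} => [|m']; first by ring.
  by rewrite !exprS /=; field; rewrite lz expf_neq0.
apply: (differentiable_eq_on D_open fE Dp); apply: differentiable_mul => //.
by apply: differentiableV; [exact: differentiable_exp|rewrite expf_neq0// l_neq0].
Qed.

End affine_powers.

Section posdef.
Variable R : realType.

(** Completing the square in the fibre block. *)
Lemma torus_form_posdef (gxx gyy gss gtt gst : R) (w : 'rV[R]_4) :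
  0 < gxx -> 0 < gyy -> 0 < gss -> 0 < gss * gtt - gst ^+ 2 -> w != 0 ->
  0 < (w *m torus_form gxx gyy gss gtt gst *m w^T) 0 0.
Proof.
move=> x0 y0 s0 d0 wn0; have s_neq0 : gss != 0 by rewrite gt_eqF.
have -> : (w *m torus_form gxx gyy gss gtt gst *m w^T) 0 0 =
    gxx * w 0 kx ^+ 2 + gyy * w 0 ky ^+ 2 +
    gss * (w 0 ks + gst / gss * w 0 kt) ^+ 2 +
    (gss * gtt - gst ^+ 2) / gss * w 0 kt ^+ 2.
  by rewrite !mxE sum_ord4 !mxE !sum_ord4 !mxE !val_index /=; field.
have e0 : 0 < (gss * gtt - gst ^+ 2) / gss by rewrite divr_gt0.
have sqr_term (r y : R) : 0 < r -> 0 <= r * y ^+ 2.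
  by move=> r0; rewrite mulr_ge0 ?sqr_ge0// ltW.
have sqr_term0 (r y : R) : 0 < r -> (r * y ^+ 2 == 0) = (y == 0).
  by move=> r0; rewrite mulf_eq0 gt_eqF// sqrf_eq0.
rewrite lt0r; apply/andP; split; last by rewrite !addr_ge0// sqr_term.
apply: contra wn0; rewrite !paddr_eq0 ?addr_ge0 ?sqr_term//.
rewrite !sqr_term0//.
move=> /andP[/andP[/andP[/eqP wx /eqP wy] ws] /eqP wt].
move: ws; rewrite wt mulr0 addr0 => /eqP ws.
by apply/eqP/rowP; apply: ord4_ind; rewrite mxE.
Qed.

End posdef.

Section cover.
Variable R : realType.

Definition base_point (p : 'rV[R]_4) : R * R := (p 0 kx, p 0 ky).

Lemma base_point_linear : linear base_point.
Proof. by move=> h p p'; rewrite /base_point !mxE. Qed.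

Lemma coord_linear n (i : 'I_n) : linear (fun p : 'rV[R]_n => p 0 i).
Proof. by move=> h p p'; rewrite !mxE. Qed.

Lemma differentiable_base_point (p : 'rV[R]_4) : differentiable base_point p.
Proof. by apply: differentiable_pair; exact: differentiable_coord. Qed.

Lemma open_cover (U : set (R * R)) : open U -> open (Defs.cover U).
Proof.
move=> U_open.
rewrite (_ : Defs.cover U = base_point @^-1` U)//; apply: open_comp => // p _.
exact/differentiable_continuous/differentiable_base_point.
Qed.

Definition lift_point (z : R * R) : 'rV[R]_4 :=
  z.1 *: delta_mx 0 kx + z.2 *: delta_mx 0 ky.

Lemma lift_pointK : cancel lift_point base_point.
Proof.
by case=> x y; rewrite /base_point !mxE -!val_eqE !val_index /= !mulr1 !mulr0 addr0 add0r.
Qed.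

Lemma base_point_kx : base_point (delta_mx 0 kx) = (1, 0).
Proof. by rewrite /base_point !mxE -!val_eqE !val_index. Qed.

Lemma base_point_ky : base_point (delta_mx 0 ky) = (0, 1).
Proof. by rewrite /base_point !mxE -!val_eqE !val_index. Qed.

Lemma base_point_ks : base_point (delta_mx 0 ks) = 0.
Proof. by rewrite /base_point !mxE -!val_eqE !val_index. Qed.

Lemma base_point_kt : base_point (delta_mx 0 kt) = 0.
Proof. by rewrite /base_point !mxE -!val_eqE !val_index. Qed.

End cover.

(** * Curvature of the torus metric *)

Section profile.
Variables (R : realType) (F : set R) (f : R -> R).
Hypotheses (f_smooth : smooth_on F f) (f_pos : forall x, F x -> 0 < f x).
Implicit Types (x : R) (p v : 'rV[R]_4) (i : 'I_4).

(** The logarithmic derivative of the square root of [f]. *)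
Definition half_dlog x := 'D_1 f x / (2 * f x).

Lemma is_derive_sqrt_profile i p v : F (p 0 i) ->
  is_derive p v (fun z => Num.sqrt (f (z 0 i)))
    (v 0 i * half_dlog (p 0 i) * Num.sqrt (f (p 0 i))).
Proof.
move=> Fp; have f0 := f_pos Fp; have fd := f_smooth nil Fp.
have s0 : Num.sqrt (f (p 0 i)) != 0 by rewrite gt_eqF ?sqrtr_gt0.
have sd : is_derive (p 0 i) 1 (Num.sqrt \o f)
    (half_dlog (p 0 i) * Num.sqrt (f (p 0 i))).
  have -> : half_dlog (p 0 i) * Num.sqrt (f (p 0 i)) =
      (2 * Num.sqrt (f (p 0 i)))^-1 * 'D_1 f (p 0 i).
    rewrite /half_dlog; move: (sqr_sqrtr (ltW f0)) s0 ('D_1 f _).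
    by move: (f _) (Num.sqrt _) => y s <- s0 d; field.
  apply: is_derive1_comp; first exact: is_derive1_sqrt.
  exact/derivableP/diff_derivable.
have sdiff : differentiable (Num.sqrt \o f) (p 0 i).
  by apply/derivable1_diffP; case: sd.
have := is_derive_comp_linear (@coord_linear R 4 i) v sdiff.
congr is_derive; rewrite deriveE// -[v 0 i in LHS]mulr1 -mulrA.
have -> : v 0 i * 1 = v 0 i *: (1 : R) by [].
by rewrite linearZ -deriveE// derive_val.
Qed.

Lemma differentiable_half_dlog i p : F (p 0 i) ->
  differentiable (fun z : 'rV[R]_4 => half_dlog (z 0 i)) p.
Proof.
move=> Fp; have f0 := f_pos Fp.
apply: (@differentiable_comp _ _ _ _ (fun z : 'rV[R]_4 => z 0 i) half_dlog).
  exact: differentiable_coord.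
apply: differentiable_mul; first exact: (f_smooth [:: 1] Fp).
apply: differentiableV; last by rewrite mulf_neq0// ?gt_eqF.
by apply: differentiable_mul => //; exact: (f_smooth nil Fp).
Qed.

End profile.

Lemma derive_prod (R : realType) (f : R * R -> R) z v d1 d2 :
    differentiable f z -> 'D_(1, 0) f z = d1 -> 'D_(0, 1) f z = d2 ->
  'D_v f z = v.1 * d1 + v.2 * d2.
Proof.
move=> fd <- <-; rewrite !deriveE//.
have {1}-> : v = v.1 *: (1, 0) + v.2 *: (0, 1).
  apply: injective_projections => /=; rewrite scaler0 ?addr0 ?add0r.
    by rewrite [_ *: _]mulr1.
  by rewrite [_ *: _]mulr1.
by rewrite linearD !linearZ.
Qed.

Section torus_metric_curvature.
Variables (R : realType) (U : set (R * R)) (theta : R) (q : R * R -> R)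
  (A B : R -> R).
Hypotheses (U_open : open U)
  (theta_gt0 : 0 < theta) (theta_lt : theta < pi / 2)
  (q_smooth : smooth_on U q) (q_pos : forall z, U z -> 0 < q z)
  (A_smooth : smooth_on (fst @` U) A)
  (A_pos : forall x, (fst @` U) x -> 0 < A x)
  (B_smooth : smooth_on (snd @` U) B)
  (B_pos : forall y, (snd @` U) y -> 0 < B y).
Implicit Types (p : 'rV[R]_4) (i j k : 'I_4).

Local Notation C := (Defs.cover U).
Local Notation g := (torus_metric theta q A B).
Let c := cos theta.
Let qt p := q (base_point p).

Lemma cos_theta_gt0 : 0 < c.
Proof.
apply: cos_gt0_pihalf; rewrite theta_lt andbT (lt_trans _ theta_gt0)//.
by rewrite oppr_lt0 divr_gt0// pi_gt0.
Qed.

Lemma sin2_theta_gt0 : 0 < 1 - c ^+ 2.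
Proof.
rewrite -sin2cos2 exprn_gt0// sin_gt0_pi// theta_gt0/=.
by rewrite (lt_trans theta_lt)// ltr_pdivrMr// ltr_pMr ?pi_gt0// ltr1n.
Qed.

Let fst_cover p : C p -> (fst @` U) (p 0 kx).
Proof. by move=> Cp; exists (base_point p). Qed.

Let snd_cover p : C p -> (snd @` U) (p 0 ky).
Proof. by move=> Cp; exists (base_point p). Qed.

Let qt_neq0 p : C p -> qt p != 0.
Proof. by move=> Cp; rewrite gt_eqF// q_pos. Qed.

Let derive_qt i p : partial i qt p = 'D_(base_point (delta_mx 0 i)) q (base_point p).
Proof. exact: (derive_comp_linear (@base_point_linear R) q p _). Qed.

Let derive2_qt i j p : partial i (partial j qt) p =
  'D_(base_point (delta_mx 0 i)) ('D_(base_point (delta_mx 0 j)) q) (base_point p).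
Proof.
rewrite (_ : partial j qt = fun z => 'D_(base_point (delta_mx 0 j)) q (base_point z)).
  exact: (derive_comp_linear (@base_point_linear R) _ p _).
by apply/funext => z; exact: derive_qt.
Qed.

Let differentiable_lift (f : R * R -> R) p : differentiable f (base_point p) ->
  differentiable (fun z => f (base_point z)) p.
Proof.
by move=> fd; apply: differentiable_comp => //; exact: differentiable_base_point.
Qed.

Let differentiable_qt p : C p -> differentiable qt p.
Proof. by move=> Cp; apply: (@differentiable_lift q); exact: (q_smooth nil Cp). Qed.

Let differentiable_partial_qt p i : C p -> differentiable (partial i qt) p.
Proof.
move=> Cp; rewrite (_ : partial i qt =
  fun z => 'D_(base_point (delta_mx 0 i)) q (base_point z)).
  apply: (@differentiable_lift ('D_(base_point (delta_mx 0 i)) q)).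
  exact: (q_smooth [:: base_point (delta_mx 0 i)] Cp).
by apply/funext => z; exact: derive_qt.
Qed.

(** On a multiple of the metric the functional of [fibre_ricci_combination]
    is zero, so a sum of squares with positive weights vanishes. *)
Lemma einstein_half_dlog0 lambda p :
  (forall z, C z -> ricci g z = lambda *: g z) -> C p ->
  half_dlog A (p 0 kx) = 0 /\ half_dlog B (p 0 ky) = 0.
Proof.
move=> ein Cp.
pose a p := Num.sqrt (A (p 0 kx)); pose b p := Num.sqrt (B (p 0 ky)).
have a_gt0 z : C z -> 0 < a z by move=> /fst_cover/A_pos; rewrite sqrtr_gt0.
have b_gt0 z : C z -> 0 < b z by move=> /snd_cover/B_pos; rewrite sqrtr_gt0.
have [a0 b0] : (forall z, C z -> a z != 0) /\ (forall z, C z -> b z != 0).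
  by split=> z Cz; rewrite gt_eqF ?a_gt0 ?b_gt0.
have gE z : C z -> g z = (qt z ^+ 2)^-1 *:
    torus_form (a z ^+ 2)^-1 (b z ^+ 2)^-1 (a z ^+ 2) (b z ^+ 2) (a z * b z * c).
  move=> Cz; have [Az Bz] := (A_pos (fst_cover Cz), B_pos (snd_cover Cz)).
  by rewrite torus_metricE sqrtrM ?ltW// !sqr_sqrtr ?ltW.
have da z i : C z -> is_derive z (delta_mx 0 i) a
    (match val i with 0 => half_dlog A (z 0 kx) | 1 => 0 | _ => 0 end * a z).
  move=> Cz; have := is_derive_sqrt_profile A_smooth A_pos (delta_mx 0 i) (fst_cover Cz).
  congr is_derive; move: i; apply: ord4_ind;
    by rewrite !mxE -!val_eqE !val_index /= ?(mul1r, mul0r).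
have db z i : C z -> is_derive z (delta_mx 0 i) b
    (match val i with 0 => 0 | 1 => half_dlog B (z 0 ky) | _ => 0 end * b z).
  move=> Cz; have := is_derive_sqrt_profile B_smooth B_pos (delta_mx 0 i) (snd_cover Cz).
  congr is_derive; move: i; apply: ord4_ind;
    by rewrite !mxE -!val_eqE !val_index /= ?(mul1r, mul0r).
pose u z := partial kx qt z / qt z; pose v z := partial ky qt z / qt z.
have dq z i : C z -> is_derive z (delta_mx 0 i) qt
    (match val i with 0 => u z | 1 => v z | _ => 0 end * qt z).
  move=> Cz; have := derivableP
    (@diff_derivable _ _ _ _ _ (delta_mx 0 i) (differentiable_qt Cz)).
  congr is_derive; move: i; apply: ord4_ind; rewrite !val_index.
  - by rewrite divfK// qt_neq0.
  - by rewrite divfK// qt_neq0.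
  - by rewrite -/(partial ks qt z) derive_qt base_point_ks derive0 mul0r.
  - by rewrite -/(partial kt qt z) derive_qt base_point_kt derive0 mul0r.
have duv i z w : C z -> derivable (fun z => partial i qt z / qt z) z w.
  move=> Cz; apply/diff_derivable/differentiable_mul.
    exact: differentiable_partial_qt.
  by apply: differentiableV; [exact: differentiable_qt|exact: qt_neq0].
have dal z w : C z -> derivable (fun z : 'rV[R]_4 => half_dlog A (z 0 kx)) z w.
  by move=> /fst_cover Fz; exact/diff_derivable/(differentiable_half_dlog A_smooth A_pos).
have dbe z w : C z -> derivable (fun z : 'rV[R]_4 => half_dlog B (z 0 ky)) z w.
  by move=> /snd_cover Fz; exact/diff_derivable/(differentiable_half_dlog B_smooth B_pos).
have c2 : 1 - c ^+ 2 != 0 by rewrite gt_eqF// sin2_theta_gt0.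
have := fibre_ricci_combination (open_cover U_open) c2 qt_neq0 a0 b0 gE dq da db
  (fun z => @duv kx z _) (fun z => @duv ky z _) (fun z => @dal z _)
  (fun z => @dbe z _) Cp.
rewrite !ein// gE// !mxE !val_index.
have [az bz] := (a_gt0 _ Cp, b_gt0 _ Cp).
have -> : 2 * (lambda * ((qt p ^+ 2)^-1 * (a p * b p * c))) / (a p * b p) -
   c * (lambda * ((qt p ^+ 2)^-1 * a p ^+ 2)) / a p ^+ 2 -
   c * (lambda * ((qt p ^+ 2)^-1 * b p ^+ 2)) / b p ^+ 2 = 0.
  move: (qt_neq0 Cp) (a0 _ Cp) (b0 _ Cp) => q0 a0' b0'.
  by move: (qt p) (a p) (b p) c q0 a0' b0' => ? ? ? ? q0 a1 b1; field; rewrite q0 a1 b1.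
move: (half_dlog A _) (half_dlog B _) => al be.
move/esym/eqP; rewrite -!exprMn mulf_eq0 (gt_eqF cos_theta_gt0) /=.
rewrite paddr_eq0 ?sqr_ge0// !sqrf_eq0 !mulf_eq0 (gt_eqF az) (gt_eqF bz) /=.
by move=> /andP[/eqP-> /eqP->].
Qed.

Section constant_profiles.
Variables (alpha beta : R).
Hypotheses (alpha_gt0 : 0 < alpha) (beta_gt0 : 0 < beta)
  (A_const : forall x, (fst @` U) x -> A x = alpha)
  (B_const : forall y, (snd @` U) y -> B y = beta).

Let gst := Num.sqrt (alpha * beta) * c.
Let K := torus_form alpha^-1 beta^-1 alpha beta gst.

Let metricE p : C p -> g p = (qt p ^+ 2)^-1 *: K.
Proof.
move=> Cp; rewrite torus_metricE A_const ?B_const//.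
  exact: snd_cover.
exact: fst_cover.
Qed.

Let detE : alpha * beta - gst ^+ 2 = alpha * beta * (1 - c ^+ 2).
Proof. by rewrite /gst exprMn sqr_sqrtr ?mulr_ge0 ?ltW//; ring. Qed.

Let det_gt0 : 0 < alpha * beta - gst ^+ 2.
Proof. by rewrite detE !mulr_gt0// sin2_theta_gt0. Qed.

Let inv_neq0 : (alpha^-1 != 0) * (beta^-1 != 0).
Proof. by rewrite !invr_eq0 !gt_eqF. Qed.

Let ricci_constant_profiles p : C p -> ricci g p = \matrix_(j, k)
  ((3 * partial j (partial k qt) p - partial k (partial j qt) p) / qt p
  + K j k * \sum_i \sum_l invmx K i l *
      (partial i (partial l qt) p / qt p
       - 3 * partial i qt p * partial l qt p / qt p ^+ 2)).
Proof.
move=> Cp; rewrite (ricci_conformally_flat (open_cover U_open) qt_neq0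
  differentiable_qt differentiable_partial_qt _ _ metricE Cp).
- by have -> : 4%:R - 1 = 3 :> R by ring.
- by rewrite torus_form_unit ?inv_neq0// gt_eqF.
- exact: torus_form_sym.
Qed.

(** Since q does not depend on s, the ss component of the Einstein equation
    determines the coefficient of K, and it cancels in all other components.
    These then say 3 d_j d_k q = d_k d_j q, for both orders of [j] and [k]. *)
Lemma einstein_hessian0 lambda p j k :
  (forall z, C z -> ricci g z = lambda *: g z) -> C p ->
  'D_(base_point (delta_mx 0 j)) ('D_(base_point (delta_mx 0 k)) q)
    (base_point p) = 0.
Proof.
move=> ein Cp; rewrite -derive2_qt; have := ein p Cp;
  rewrite ricci_constant_profiles// metricE//.
set S := \sum_i _; move/matrixP => E.
have q0 := qt_neq0 Cp.
have SE : S = lambda * (qt p ^+ 2)^-1.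
  have := E ks ks; rewrite !mxE !derive2_qt base_point_ks derive0 mulr0 subrr mul0r.
  rewrite add0r val_index [in X in _ = X]mulrA [in X in X = _]mulrC => /mulIf.
  by apply; rewrite gt_eqF.
have H j' k' : 3 * partial j' (partial k' qt) p = partial k' (partial j' qt) p.
  have := E j' k'; rewrite SE [LHS]mxE [RHS]mxE [X in _ = _ * X]mxE => e.
  apply/eqP; rewrite -subr_eq0 -[_ == 0](mulIr_eq0 _ (mulIf (invr_neq0 q0))).
  apply/eqP; apply: (addIr (K j' k' * (lambda / qt p ^+ 2))).
  by rewrite add0r e; ring.
have := H j k; have := H k j.
by move: (partial j _ p) (partial k _ p) => x y; lra.
Qed.

Section affine_factor.
Variables (a b d : R).
Hypothesis q_affine : forall x y, U (x, y) -> q (x, y) = a * x + b * y + d.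

Let ell (p : 'rV[R]_4) := a * p 0 kx + b * p 0 ky + d.

Let qtE : {in C, ell =1 qt}.
Proof. by move=> p; rewrite inE => Cp; rewrite /qt q_affine. Qed.

Let is_derive_ell p v : is_derive p v ell (a * v 0 kx + b * v 0 ky).
Proof.
have coord i : is_derive p v (fun z : 'rV[R]_4 => z 0 i) (v 0 i).
  have := is_derive_comp_linear (@coord_linear R 4 i) v (f := id) (p := p).
  by rewrite derive_id; apply.
by rewrite -[_ + _]addr0; apply: is_derive_add.
Qed.

Let differentiable_ell p : differentiable ell p.
Proof.
apply: differentiableD; last exact: differentiable_cst.
by apply: differentiableD; apply: differentiable_mul;
  [exact: differentiable_cst|exact: differentiable_coord|
   exact: differentiable_cst|exact: differentiable_coord].
Qed.

Let slope i : R := match val i with 0 => a | 1 => b | _ => 0 end.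

Let partial_qt i p : C p -> partial i qt p = slope i.
Proof.
move=> Cp; rewrite /partial -(derive_eq_on _ (open_cover U_open) qtE Cp).
rewrite (@derive_val _ _ _ _ _ _ _ (is_derive_ell p (delta_mx 0 i))) /slope.
move: i; apply: ord4_ind;
  by rewrite !mxE -!val_eqE !val_index /= ?(mulr1, mulr0, addr0, add0r).
Qed.

Let partial2_qt i j p : C p -> partial i (partial j qt) p = 0.
Proof.
move=> Cp; rewrite /partial (derive_eq_on (g := cst (slope j)) _ (open_cover U_open) _ Cp).
  exact: derive_cst.
by move=> z; rewrite inE; exact: partial_qt.
Qed.

(** With vanishing second derivatives of q only the term in |dq|^2 of the
    conformal formula is left, and K^-1 has base block diag(alpha, beta). *)
Lemma ricci_affine p : C p ->
  ricci g p = (- 3 * (a ^+ 2 * alpha + b ^+ 2 * beta)) *: g p.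
Proof.
move=> Cp; have q0 := qt_neq0 Cp; rewrite ricci_constant_profiles// metricE//.
rewrite invmx_torus_form ?inv_neq0 ?gt_eqF//.
apply/matrixP => j k; rewrite [LHS]mxE [RHS]mxE [X in _ = _ * X]mxE.
move: (K j k) (qt p) q0 => y r r0.
rewrite (eq_bigr (fun i => \sum_l torus_form alpha^-1^-1 beta^-1^-1
    (beta / (alpha * beta - gst ^+ 2)) (alpha / (alpha * beta - gst ^+ 2))
    (- gst / (alpha * beta - gst ^+ 2)) i l * (0 / r - 3 * slope i * slope l / r ^+ 2)));
  last by move=> i _; apply: eq_bigr => l _; rewrite partial2_qt// !partial_qt.
rewrite !partial2_qt// !sum_ord4 /slope !mxE !val_index !invrK.
move: (_ - gst ^+ 2) (lt0r_neq0 det_gt0) => e e0.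
by field; rewrite e0 r0.
Qed.

(** On the cover the metric equals K / l^2 with [l] the affine function of
    the coordinates, which is where the smoothness of the components comes from. *)
Lemma riemannian_metric_affine Gamma : riemannian_metric U Gamma g.
Proof.
split=> [i j|gam p _ Cp|p Cp|p v Cp v0].
- apply: (@smooth_on_eq _ _ C (fun p => K i j * (ell p ^+ 2)^-1)).
  + exact: open_cover.
  + by move=> p; rewrite inE => Cp; rewrite metricE// [RHS]mxE mulrC qtE ?inE.
  + apply: (smooth_affine_inv_power (open_cover U_open) _ differentiable_ell
      (fun p v => @derive_val _ _ _ _ _ _ _ (is_derive_ell p v))).
    by move=> p Cp; rewrite qtE ?inE//; exact: qt_neq0.
- by rewrite /torus_metric /translate !mxE -!val_eqE !val_index /= !mulr0 !addr0.
- by rewrite metricE// linearZ /= torus_form_sym.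
- rewrite metricE// -scalemxAr -scalemxAl mxE mulr_gt0 ?torus_form_posdef//.
  + by rewrite invr_gt0 exprn_gt0// q_pos.
  + by rewrite invr_gt0.
  + by rewrite invr_gt0.
Qed.

End affine_factor.

End constant_profiles.

End torus_metric_curvature.

(** * Einstein solutions *)

Lemma profile_constant (R : realType) (F : set R) (f : R -> R) :
    open F -> connected F -> smooth_on F f -> (forall x, F x -> 0 < f x) ->
    (forall x, F x -> half_dlog f x = 0) ->
  forall x y, F x -> F y -> f y = f x.
Proof.
move=> oF cF fs f0 fl; apply: derive0_constant_on => //.
  by move=> x; exact: (fs nil).
move=> x v Fx; have fd : differentiable f x := fs nil x Fx.
have /eqP := fl x Fx; rewrite mulf_eq0 invr_eq0 [_ * f x == 0]mulf_eq0.
rewrite pnatr_eq0 (gt_eqF (f0 x Fx)) !orbF => /eqP fx0.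
by rewrite deriveE// -[v]mulr1 [v * 1]/(v *: 1) linearZ /= -deriveE// fx0 scaler0.
Qed.

Section einstein_solutions.
Variables (R : realType) (U : set (R * R)) (theta : R)
  (q : R * R -> R) (A B : R -> R).
Hypotheses (U_nonempty : U !=set0) (U_open : open U) (U_connected : connected U)
  (theta_gt0 : 0 < theta) (theta_lt : theta < pi / 2)
  (q_smooth : smooth_on U q) (q_pos : forall z, U z -> 0 < q z)
  (A_smooth : smooth_on (fst @` U) A)
  (A_pos : forall x, (fst @` U) x -> 0 < A x)
  (B_smooth : smooth_on (snd @` U) B)
  (B_pos : forall y, (snd @` U) y -> 0 < B y).

Local Notation C := (Defs.cover U).
Local Notation g := (torus_metric theta q A B).

Let lift_cover z : U z -> C (lift_point z).
Proof. by move=> Uz; rewrite /Defs.cover /= -/(base_point _) lift_pointK. Qed.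

(** The two first partial derivatives are constant on the connected set [U];
    subtracting the corresponding linear function leaves a function with zero
    derivative. *)
Lemma hessian0_affine :
    (forall z, U z -> [/\ 'D_(1, 0) ('D_(1, 0) q) z = 0, 'D_(0, 1) ('D_(1, 0) q) z = 0,
       'D_(1, 0) ('D_(0, 1) q) z = 0 & 'D_(0, 1) ('D_(0, 1) q) z = 0]) ->
  exists a b d, forall x y, U (x, y) -> q (x, y) = a * x + b * y + d.
Proof.
move=> hess0; have [z0 Uz0] := U_nonempty.
have dq v z : U z -> differentiable ('D_v q) z by exact: (q_smooth [:: v]).
have qd z : U z -> differentiable q z by exact: (q_smooth nil).
have cst1 z : U z -> 'D_(1, 0) q z = 'D_(1, 0) q z0.
  apply: (derive0_constant_on U_open U_connected (@dq (1, 0))) => // p v Up.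
  have [h1 h2 _ _] := hess0 p Up.
  by rewrite (derive_prod v (dq (1, 0) p Up) h1 h2) !mulr0 addr0.
have cst2 z : U z -> 'D_(0, 1) q z = 'D_(0, 1) q z0.
  apply: (derive0_constant_on U_open U_connected (@dq (0, 1))) => // p v Up.
  have [_ _ h1 h2] := hess0 p Up.
  by rewrite (derive_prod v (dq (0, 1) p Up) h1 h2) !mulr0 addr0.
set a := 'D_(1, 0) q z0 in cst1; set b := 'D_(0, 1) q z0 in cst2.
pose r (z : R * R) := q z - (a * z.1 + b * z.2).
exists a, b, (r z0) => x y Uxy.
suff -> : r z0 = r (x, y) by rewrite /r /=; ring.
have fst_diff p : differentiable (fst : R * R -> R) p.
  by apply: linear_differentiable => z; exact: cvg_fst.
have snd_diff p : differentiable (snd : R * R -> R) p.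
  by apply: linear_differentiable => z; exact: cvg_snd.
have fst_der p v : is_derive p v (fst : R * R -> R) v.1.
  apply: DeriveDef; first exact: diff_derivable.
  by rewrite deriveE// diff_lin// => z; exact: cvg_fst.
have snd_der p v : is_derive p v (snd : R * R -> R) v.2.
  apply: DeriveDef; first exact: diff_derivable.
  by rewrite deriveE// diff_lin// => z; exact: cvg_snd.
apply: (derive0_constant_on U_open U_connected _ _ Uxy Uz0) => [p Up|p v Up].
  apply: differentiableB; first exact: qd.
  by apply: differentiableD; apply: differentiable_mul => //; exact: differentiable_cst.
rewrite (@derive_val _ _ _ _ _ _ _ (is_derive_sub
  (derivableP (@diff_derivable _ _ _ _ p v (qd p Up)))
  (is_derive_add (is_derive_scale a (fst_der p v)) (is_derive_scale b (snd_der p v))))).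
rewrite (derive_prod v (qd p Up) (cst1 p Up) (cst2 p Up)).
by rewrite -/a -/b; ring.
Qed.

Lemma einstein_affine lambda :
    (forall p, C p -> ricci g p = lambda *: g p) ->
  exists alpha beta a b d, affine_solution U q A B alpha beta a b d.
Proof.
move=> ein; have [[x0 y0] Uz0] := U_nonempty.
have flat z : U z -> half_dlog A z.1 = 0 /\ half_dlog B z.2 = 0.
  move=> Uz; have := einstein_half_dlog0 U_open theta_gt0 theta_lt q_smooth
    q_pos A_smooth A_pos B_smooth B_pos ein (lift_cover Uz).
  rewrite -[lift_point z 0 kx]/(base_point (lift_point z)).1.
  by rewrite -[lift_point z 0 ky]/(base_point (lift_point z)).2 lift_pointK.
have F0 : (fst @` U) x0 by exists (x0, y0).
have S0 : (snd @` U) y0 by exists (x0, y0).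
have A_const x : (fst @` U) x -> A x = A x0.
  move=> Fx; apply: (profile_constant (fst_open U_open) _ A_smooth A_pos _ F0 Fx).
    apply: connected_continuous_connected => //.
    by apply: continuous_subspaceT => z; exact: cvg_fst.
  by move=> _ [z Uz <-]; have [] := flat z Uz.
have B_const y : (snd @` U) y -> B y = B y0.
  move=> Sy; apply: (profile_constant (snd_open U_open) _ B_smooth B_pos _ S0 Sy).
    apply: connected_continuous_connected => //.
    by apply: continuous_subspaceT => z; exact: cvg_snd.
  by move=> _ [z Uz <-]; have [] := flat z Uz.
have [|a [b [d qE]]] := hessian0_affine; last by exists (A x0), (B y0), a, b, d; split.
move=> z Uz; have hess j k := einstein_hessian0 U_open theta_gt0 theta_lt q_smooth
  q_pos (A_pos F0) (B_pos S0) A_const B_const j k ein (lift_cover Uz).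
rewrite lift_pointK in hess.
by split; [have := hess kx kx|have := hess ky kx|have := hess kx ky|have := hess ky ky];
  rewrite ?base_point_kx ?base_point_ky.
Qed.

End einstein_solutions.

Theorem corollary1p2 (R : realType) (U : set (R * R)) (Gamma : set 'rV[R]_2)
    (theta : R) (q : R * R -> R) (A B : R -> R)
    (U_nonempty : U !=set0) (U_open : open U) (U_connected : connected U)
    (Gamma_lattice : lattice Gamma)
    (theta_gt0 : 0 < theta) (theta_lt : theta < pi / 2)
    (q_smooth : smooth_on U q) (q_pos : forall z, U z -> 0 < q z)
    (A_smooth : smooth_on (fst @` U) A)
    (A_pos : forall x, (fst @` U) x -> 0 < A x)
    (B_smooth : smooth_on (snd @` U) B)
    (B_pos : forall y, (snd @` U) y -> 0 < B y) :
  (einstein U Gamma (torus_metric theta q A B) <->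
     exists alpha beta a b c : R, affine_solution U q A B alpha beta a b c)
  /\
  (forall lambda alpha beta a b c : R,
     affine_solution U q A B alpha beta a b c ->
     einstein_with U Gamma (torus_metric theta q A B) lambda ->
     lambda = - 3 * (a ^+ 2 * alpha + b ^+ 2 * beta)).
Proof.
have [[x0 y0] Uz0] := U_nonempty.
have positive alpha beta a b c : affine_solution U q A B alpha beta a b c ->
    0 < alpha /\ 0 < beta.
  move=> [Ac Bc _]; rewrite -(Ac x0) -?(Bc y0); try by exists (x0, y0).
  by split; [apply: A_pos|apply: B_pos]; exists (x0, y0).
split; last first.
  move=> lambda alpha beta a b c sol [met ein]; have [a0 b0] := positive _ _ _ _ _ sol.
  have [Ac Bc qc] := sol; pose p := lift_point (x0, y0).
  have Cp : Defs.cover U p.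
    by rewrite /Defs.cover /= -/(base_point _) lift_pointK.
  have := ricci_affine U_open theta_gt0 theta_lt q_smooth q_pos a0 b0 Ac Bc qc Cp.
  have e_neq0 : (delta_mx 0 ks : 'rV[R]_4) != 0.
    by apply/eqP => /matrixP/(_ 0 ks)/eqP; rewrite !mxE !eqxx oner_eq0.
  have g_neq0 : torus_metric theta q A B p != 0.
    apply: contraTneq (metric_posdef met Cp e_neq0) => ->.
    by rewrite mulmx0 mul0mx mxE ltxx.
  rewrite ein// => /eqP; rewrite -subr_eq0 -scalerBl scaler_eq0 (negPf g_neq0) orbF.
  by rewrite subr_eq0 => /eqP.
split=> [[lambda [_ ein]]|[alpha [beta [a [b [c sol]]]]]].
  exact: (einstein_affine U_nonempty U_open U_connected theta_gt0 theta_lt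
    q_smooth q_pos A_smooth A_pos B_smooth B_pos ein).
have [a0 b0] := positive _ _ _ _ _ sol; have [Ac Bc qc] := sol.
exists (- 3 * (a ^+ 2 * alpha + b ^+ 2 * beta)); split.
  exact: (riemannian_metric_affine U_open theta_gt0 theta_lt q_pos a0 b0 Ac Bc qc).
move=> p Cp.
exact: (ricci_affine U_open theta_gt0 theta_lt q_smooth q_pos a0 b0 Ac Bc qc Cp).
Qed.
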